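(* Let $\Gamma$ be a class of topological spaces and assume $\mathtt{OGD}^{\mathbb{N}}(\Gamma)$. Suppose that $D$ is a countable discrete set, $(X_d)_{d\in D}$ is a sequence of metric spaces, $R,S\subseteq\prod_{d\in D}X_d$ are disjoint, and $R\in\Gamma$. Then exactly one of the following holds: (1) there is a countable union of closed hyperrectangles separating $R$ from $S$; (2) there is a continuous hyperrectangular homomorphism from the pair $(\triangle^D((D\times\mathbb{N})^{\mathbb{N}}),\ \mathbb{H}_{(D\times\mathbb{N})^{\mathbb{N}},\infty})$ to the pair $(R,S)$.
   Context: Base theory: $\mathsf{ZF}+\mathsf{DC}$. $\prod_{d\in D}X_d$ carries the product topology, and $R\in\Gamma$ refers to $R$ with the subspace topology. A hyperrectangle in $\prod_{d}X_d$ is a set $\prod_{d}Y_d$ with $Y_d\subseteq X_d$; it is closed if it is of this form with every $Y_d$ closed. A set $C$ separates $A$ from $B$ if $A\subseteq C$ and $B\cap C=\emptyset$. $\triangle^D(Z)$ is the set of all constant $D$-sequences of elements of $Z$. $\mathbb{N}_*=\mathbb{N}\cup\{\infty\}$ is the one-point compactification of $\mathbb{N}$, and $D\times\mathbb{N}_*$ has the product topology ($D$ discrete). For a topological space $X$ and a discrete set $E\subseteq X$, $\mathrm{Ext}_X(E^{\mathbb{N}})=E^{\mathbb{N}}\cup\{t\cdot(x) : t\in E^{<\mathbb{N}},\ x\in X\setminus E\}$, with the topology generated by the sets $\mathcal{N}_{t,U}=\{b\in\mathrm{Ext}_X(E^{\mathbb{N}}) : t\sqsubset b\text{ and }b(|t|)\in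 U\}$ for $t\in E^{<\mathbb{N}}$ and $U\subseteq X$ open ($E^{<\mathbb N}$ denotes finite sequences, $\sqsubset$ strict extension, $|t|$ length, $t\cdot(x)$ is $t$ followed by the single entry $x$). $\mathbb{H}_{(D\times\mathbb{N})^{\mathbb{N}},\infty}$ is the $D$-ary relation on $\mathrm{Ext}_{D\times\mathbb{N}_*}((D\times\mathbb{N})^{\mathbb{N}})$ consisting of all sequences $(t\cdot((d,\infty)))_{d\in D}$ with $t\in(D\times\mathbb{N})^{<\mathbb{N}}$. A hyperrectangular homomorphism from a sequence $(R_i)_{i\in I}$ of subsets of $\prod_{d}Z_d$ to a sequence $(S_i)_{i\in I}$ of subsets of $\prod_{d}Y_d$ is a function $\phi=\prod_{d\in D}\phi_d$, where $\phi_d\colon\bigcup_{i\in I}\mathrm{proj}_d(R_i)\to Y_d$ for all $d\in D$, such that $\phi(R_i)\subseteq S_i$ for all $i\in I$; it is continuous if every $\phi_d$ is (here the domains have the subspace topology from $\mathrm{Ext}_{D\times\mathbb{N}_*}((D\times\mathbb{N})^{\mathbb{N}})$). Definition of $\mathtt{OGD}^{\mathbb{N}}(\Gamma)$: for every $Z\in\Gamma$ and every box-open $\mathbb{N}$-dimensional dihypergraph $H$ on $Z$, either $H$ has chromatic number at most $\aleph_0$ or there is a continuous homomorphism from $\mathbb{H}_{\mathbb{N}^{\mathbb{N}}}$ to $H$. Here an $\mathbb{N}$-dimensional dihypergraph on $Z$ is a subset of $Z^{\mathbb{N}}$ containing no constant sequence; it is box-open if it is open in the topology on $Z^{\mathbb{N}}$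 generated by the sets $\prod_n U_n$ with all $U_n\subseteq Z$ open; a homomorphism from $R\subseteq W^{\mathbb{N}}$ to $S\subseteq Z^{\mathbb{N}}$ is a map $\pi\colon W\to Z$ sending, coordinatewise, elements of $R$ to elements of $S$; the chromatic number of $H$ is the least cardinal $\kappa$ for which there is a map from $Z$ to a set of cardinality $\kappa$ that is non-constant along every element of $H$; and $\mathbb{H}_{\mathbb{N}^{\mathbb{N}}}=\bigcup_{t\in\mathbb{N}^{<\mathbb{N}}}\prod_{n\in\mathbb{N}}\mathcal{N}_{t\cdot(n)}$, where $\mathcal{N}_s=\{b\in\mathbb{N}^{\mathbb{N}} : s\sqsubseteq b\}$. *)

(* Defs.v *)
From HB Require Import structures.
From mathcomp Require Import all_boot all_order all_algebra.
From mathcomp Require Import all_classical all_reals all_analysis.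

Set Implicit Arguments.
Unset Strict Implicit.
Unset Printing Implicit Defensive.

Local Open Scope classical_set_scope.
Local Open Scope card_scope.

Section Dihypergraphs.
Variable Z : Type.
Implicit Types H : set (nat -> Z).

Definition dihypergraph H : Prop := forall z : Z, ~ H (fun=> z).

Definition colouring H (kappa : Type) (c : Z -> kappa) : Prop :=
  forall x, H x -> ~ exists k : kappa, forall n, c (x n) = k.

(* Cardinals are represented by arbitrary types, compared by injections. *)
Definition chromatic_number H (kappa : Type) : Prop :=
  (exists c : Z -> kappa, colouring H c) /\
  forall (lambda : Type) (c : Z -> lambda),
    colouring H c -> [set: kappa] #<= [set: lambda].

Definition countable_chromatic_number H : Prop :=
  exists kappa : Type, chromatic_number H kappa /\ [set: kappa] #<= [set: nat].

End Dihypergraphs.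

(* An alias, so that the box topology does not conflict with the product
   topology on functions. *)
Definition box_seq (Z : Type) : Type := nat -> Z.

Definition is_open_box (Z : topologicalType) (B : set (box_seq Z)) : Prop :=
  exists U : nat -> set Z,
    (forall n, open (U n)) /\ B = [set x | forall n, U n (x n)].

HB.instance Definition _ (Z : Type) := gen_eqMixin (box_seq Z).
HB.instance Definition _ (Z : Type) := gen_choiceMixin (box_seq Z).
HB.instance Definition _ (Z : topologicalType) :=
  @isSubBaseTopological.Build (box_seq Z) (set (box_seq Z))
    (@is_open_box Z) id.

Definition box_open (Z : topologicalType) (H : set (nat -> Z)) : Prop :=
  open (H : set (box_seq Z)).

Definition homomorphism (W Z : Type) (R : set (nat -> W)) (S : set (nat -> Z))
    (pi : W -> Z) : Prop :=
  forall x, R x -> S (fun n => pi (x n)).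

Definition baire : topologicalType := prod_topology (fun _ : nat => nat).

Definition baire_cyl (s : seq nat) : set baire :=
  [set b | forall i, i < size s -> b i = nth 0 s i].

Definition H_baire : set (nat -> baire) :=
  \bigcup_(t in [set: seq nat])
    [set x | forall n, baire_cyl (rcons t n) (x n)].

Definition OGD (Gamma : topologicalType -> Prop) : Prop :=
  forall Z : topologicalType, Gamma Z ->
  forall H : set (nat -> Z), dihypergraph H -> box_open H ->
    countable_chromatic_number H \/
    exists pi : baire -> Z, continuous pi /\ homomorphism H_baire H pi.

(* [ExtInf b] is the infinite sequence b; [ExtFin t x] is t . (x). *)
Variant Ext (X : topologicalType) (E : set X) : Type :=
  | ExtInf of nat -> set_type E
  | ExtFin of seq (set_type E) & set_type (~` E).

Section ExtTopology.
Variables (X : topologicalType) (E : set X).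

(* The entry at a given position, or None beyond the end of the sequence. *)
Definition ext_entry (b : Ext E) (n : nat) : option X :=
  match b with
  | ExtInf b => Some (set_val (b n))
  | ExtFin t x => onth (rcons (map set_val t) (set_val x)) n
  end.

(* t is strictly extended by b exactly when the entries of t are initial
   entries of b and b has an entry at position |t|. *)
Definition ext_nbhd (t : seq (set_type E)) (U : set X) : set (Ext E) :=
  [set b | (forall i, i < size t -> ext_entry b i = onth (map set_val t) i) /\
           exists2 y, ext_entry b (size t) = Some y & U y].

Definition is_ext_nbhd (A : set (Ext E)) : Prop :=
  exists t U, open U /\ A = ext_nbhd t U.

HB.instance Definition _ := gen_eqMixin (Ext E).
HB.instance Definition _ := gen_choiceMixin (Ext E).
HB.instance Definition _ :=
  @isSubBaseTopological.Build (Ext E) (set (Ext E)) is_ext_nbhd id.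

Definition Ext_infinite : set (Ext E) := range (@ExtInf X E).

End ExtTopology.

Arguments Ext_infinite {X} E.

Definition Nstar : topologicalType := one_point_compactification nat.

Section HInfinity.
Variable D : discreteTopologicalType.

Definition DNstar : topologicalType := (D * Nstar)%type.

Definition DN : set DNstar := [set: D] `*` range (@Some nat).

Lemma DN_infty (d : D) : (~` DN) (d, None).
Proof. by move=> [_ [n _]]. Qed.

Definition DN_infty_pt (d : D) : set_type (~` DN) :=
  SigSub (mem_set (@DN_infty d)).

Definition H_infty : set (D -> Ext DN) :=
  [set x | exists t : seq (set_type DN),
             forall d, x d = ExtFin t (DN_infty_pt d)].

End HInfinity.

Arguments DN D : clear implicits.
Arguments H_infty D : clear implicits.

(* When D is empty, the empty sequence counts as constant. *)
Definition constant_seqs (D Z : Type) (A : set Z) : set (D -> Z) :=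
  [set x | (forall d, A (x d)) /\ forall d d', x d = x d'].
Arguments constant_seqs : clear implicits.

Section Hyperrectangles.
Variable D : Type.

Definition closed_hyperrectangle (X : D -> topologicalType)
    (C : set (forall d, X d)) : Prop :=
  exists Y : forall d, set (X d),
    (forall d, closed (Y d)) /\ C = [set x | forall d, Y d (x d)].

Definition separates (T : Type) (C A B : set T) : Prop :=
  A `<=` C /\ B `&` C = set0.

Variables (Z Y : D -> topologicalType) (I : Type).

Definition hom_dom (R : I -> set (forall d, Z d)) (d : D) : set (Z d) :=
  \bigcup_i (proj d @` R i).
Arguments hom_dom R d : clear implicits.

(* Every element of R i lifts uniquely to a family of points of the domains
   [hom_dom R d]; the condition phi (R i) `<=` S i is stated on these lifts. *)
Definition hyperrectangular_hom
    (R : I -> set (forall d, Z d)) (S : I -> set (forall d, Y d))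
    (phi : forall d, set_type (hom_dom R d) -> Y d) : Prop :=
  forall i (x : forall d, set_type (hom_dom R d)),
    R i (fun d => set_val (x d)) -> S i (fun d => phi d (x d)).

Definition has_continuous_hyperrectangular_hom
    (R : I -> set (forall d, Z d)) (S : I -> set (forall d, Y d)) : Prop :=
  exists phi : forall d, set_type (hom_dom R d) -> Y d,
    (forall d, continuous (phi d)) /\ hyperrectangular_hom S phi.

End Hyperrectangles.

Definition pair_seq (T : Type) (A B : T) : bool -> T :=
  fun i => if i then A else B.

(* Main.v *)
(** On R, consider the sequences (x_(d,k)) for which some s in S satisfies
    dist (x_(d,k)(d), s(d)) < 1/(k+1) for all d and k. A monochromatic set of a
    colouring of this box-open dihypergraph has a closed hyperrectangular hull
    disjoint from S, so a countable colouring separates R from S. Otherwise a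
    homomorphism pi from the Baire space induces b |-> pi(b)(d) on infinite
    sequences, and the image of t.(d,oo) is the d-th coordinate of the common
    limit s_t in S of the points pi(b) with b extending t.(d,k), k -> oo.
    The two alternatives exclude each other by the Baire category theorem: one
    of the closed hyperrectangles contains the images of a whole cylinder of t,
    hence of the points t.(d,oo) in its closure. *)
Require Import Defs.
From HB Require Import structures.
From mathcomp Require Import all_boot all_order all_algebra.
From mathcomp Require Import all_classical all_reals all_analysis.

Set Implicit Arguments.
Unset Strict Implicit.
Unset Printing Implicit Defensive.

Local Open Scope classical_set_scope.
Local Open Scope card_scope.

(** * Cylinders and Baire category *)

Definition cylinder (T : Type) (t : seq T) : set (nat -> T) :=
  [set b | mkseq b (size t) = t].
Arguments cylinder {T}.

Lemma mem_cylinder_mkseq (T : Type) (b : nat -> T) (m : nat) :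
  cylinder (mkseq b m) b.
Proof. by rewrite /cylinder /= size_mkseq. Qed.

Lemma cylinderP (T : Type) (x0 : T) (t : seq T) (b : nat -> T) :
  cylinder t b <-> forall i, i < size t -> b i = nth x0 t i.
Proof.
split=> [<- i|tb]; first by rewrite size_mkseq => it; rewrite nth_mkseq.
apply: (@eq_from_nth _ x0); rewrite ?size_mkseq // => i it.
by rewrite nth_mkseq // tb.
Qed.

Lemma cylinder_rcons (T : Type) (t : seq T) (x : T) (b : nat -> T) :
  cylinder (rcons t x) b <-> cylinder t b /\ b (size t) = x.
Proof.
rewrite /cylinder /= size_rcons mkseqS; split=> [/rcons_inj[-> ->]//|[-> ->]//].
Qed.

Lemma cylinder_inhabited (T : Type) (x0 : T) (t : seq T) :
  exists b, cylinder t b.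
Proof. by exists (nth x0 t); apply/(cylinderP x0). Qed.

(** Baire category for discrete [T], with closedness of [B n] phrased by cylinders. If no [B n]
    contained a cylinder, finite sequences could be extended to leave [B 0], [B 1], ... in turn, and
    their limit would lie in no [B n]. *)
Lemma cylinder_baire (T : Type) (x0 : T) (B : nat -> set (nat -> T)) :
  (forall b, exists n, B n b) ->
  (forall n b, ~ B n b ->
     exists m, cylinder (mkseq b m) `<=` ~` B n) ->
  exists n t, cylinder t `<=` B n.
Proof.
move=> Bcov Bcl; apply: contrapT => noBt.
have step (p : nat * seq T) : exists t' : seq T,
    [/\ size p.2 < size t', take (size p.2) t' = p.2 &
        cylinder t' `<=` ~` B p.1].
  case: p => n t /=.
  have [b [tb nBb]] : exists b, cylinder t b /\ ~ B n b.
    apply: contrapT => nb; apply: noBt; exists n, t => b tb.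
    by apply: contrapT => nBb; apply: nb; exists b.
  have [m mB] := Bcl n b nBb.
  (* Length [m] keeps the cylinder off [B n]; length [(size t).+1] forces strict growth, hence an
     infinite limit. *)
  exists (mkseq b (maxn m (size t).+1)); rewrite size_mkseq leq_maxr.
  split=> //.
    rewrite /mkseq -map_take take_iota; rewrite (minn_idPl _) //.
    by rewrite (leq_trans (leqnSn _)) // leq_maxr.
  move=> c cb; apply: mB; apply/(cylinderP x0) => i; rewrite size_mkseq => im.
  have im' : i < maxn m (size t).+1 by rewrite leq_max im.
  move/(cylinderP x0): cb => ->; last by rewrite size_mkseq.
  by rewrite !nth_mkseq.
have [f fP] := choice step.
pose t := fix t n := if n is n.+1 then f (n, t n) else [::].
have tS n : [/\ size (t n) < size (t n.+1), take (size (t n)) (t n.+1) = t n &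
    cylinder (t n.+1) `<=` ~` B n] := fP (n, t n).
have size_t n : n <= size (t n).
  by elim: n => // n IH; case: (tS n) => h _ _; exact: leq_ltn_trans h.
have nth_t n m i : n <= m -> i < size (t n) -> nth x0 (t m) i = nth x0 (t n) i.
  move=> nm ni; elim: m nm => [|m IH]; first by rewrite leqn0 => /eqP ->.
  rewrite leq_eqVlt => /predU1P[->//|]; rewrite ltnS => nm.
  have im : i < size (t m).
    rewrite (leq_trans ni) //; elim: (m) nm => [|k IHk].
      by rewrite leqn0 => /eqP ->.
    rewrite leq_eqVlt => /predU1P[->//|]; rewrite ltnS => /IHk h.
    by case: (tS k) => /ltnW h' _ _; exact: leq_trans h'.
  by case: (tS m) => _ tk _; rewrite -IH // -[in RHS]tk nth_take.
pose b i := nth x0 (t i.+1) i.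
have tb n : cylinder (t n) b.
  apply/(cylinderP x0) => i it; rewrite /b.
  rewrite -(nth_t _ (maxn n i.+1)) ?leq_maxr //.
  by rewrite (nth_t n) // leq_maxl.
have [n Bnb] := Bcov b.
by case: (tS n) => _ _ /(_ b (tb n.+1)).
Qed.

(** * Neighbourhoods in [Ext E] *)

Section ExtTopologyTheory.
Variables (X : topologicalType) (E : set X).

Lemma open_ext_nbhd (t : seq (set_type E)) (U : set X) :
  open U -> open (ext_nbhd t U).
Proof.
move=> oU; exists [set ext_nbhd t U]; last by rewrite bigcup_set1.
by move=> _ ->; apply: finI_from1; exists t, U.
Qed.

(** Subbasic neighbourhoods suffice, since a filter is closed under finite intersections. *)
Lemma cvg_ext (F : set_system (Ext E)) (FF : Filter F) (b : Ext E) :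
  (forall t U, open U -> ext_nbhd t U b -> F (ext_nbhd t U)) ->
  F `=>` nbhs b.
Proof.
move=> Fb A; rewrite nbhsE => -[_ [[G GE <-] [C GC Cb] /filterS]]; apply.
have [J Jsub CE] := GE _ GC.
apply: (@filterS _ _ _ C); first by move=> x Cx; exists C.
have {}Cb : (C : set (Ext E)) b by [].
rewrite -CE in Cb *; apply: filter_bigI => i Ji.
have /Jsub := Ji; rewrite inE => -[t [U [oU iE]]].
rewrite iE; apply: Fb => //; rewrite -iE; exact: Cb.
Qed.

Lemma onth_cylinder (t : seq (set_type E)) b i :
  cylinder t b -> i < size t -> onth (map set_val t) i = Some (set_val (b i)).
Proof.
move=> tb it; have /(cylinderP (b 0)) -> // := tb.
by rewrite onthE -map_comp (nth_map (b 0)).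
Qed.

Lemma ext_nbhd_ExtInf (t : seq (set_type E)) (U : set X) b :
  ext_nbhd t U (ExtInf b) <-> cylinder t b /\ U (set_val (b (size t))).
Proof.
split=> [[tb [_ /= [<-]]]|[tb Ub]].
  split=> //; apply/(cylinderP (b 0)) => i it.
  move: (tb i it).
  by rewrite /= onthE -map_comp (nth_map (b 0)) //= => -[/val_inj].
split; last by exists (set_val (b (size t))).
by move=> i it; rewrite (onth_cylinder tb it).
Qed.

Lemma ext_entry_cylinder (t : seq (set_type E)) x b i :
  cylinder t b -> i < size t ->
  ext_entry (ExtInf b) i = ext_entry (ExtFin t x) i.
Proof.
by move=> tb it; rewrite /= -cats1 onth_cat size_map it (onth_cylinder tb it).
Qed.

(** A subbasic set given by [t] and [U] reads entries up to position [size t] only, so the images of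
    the cylinders around [b] generate a filter converging to [ExtInf b]. *)
Lemma nbhs_ExtInf (b : nat -> set_type E) (V : set (Ext E)) :
  nbhs (ExtInf b) V ->
  exists m, cylinder (mkseq b m) `<=` (fun c => V (ExtInf c)).
Proof.
pose F := filter_from [set: nat] (fun m => @ExtInf X E @` cylinder (mkseq b m)).
have FF : Filter F.
  apply: filter_fromT_filter; first by exists 0.
  move=> m n; exists (maxn m n) => _ [c cb <-].
  have cmn k : k <= maxn m n -> cylinder (mkseq b k) c.
    move=> kmn; apply/(cylinderP (b 0)) => i; rewrite size_mkseq => ik.
    move/(cylinderP (b 0)): cb => ->; last by rewrite size_mkseq (leq_trans ik).
    by rewrite !nth_mkseq // (leq_trans ik).
  by split; exists c => //; apply: cmn; rewrite ?leq_maxl ?leq_maxr.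
move=> /(@cvg_ext F FF) [].
  2: by move=> m _ mV; exists m => c mc; apply: mV; exists c.
move=> t U oU /ext_nbhd_ExtInf[tb Ub]; exists (size t).+1 => // _ [c + <-].
rewrite mkseqS => /cylinder_rcons[]; rewrite tb => tc cb.
by apply/ext_nbhd_ExtInf; rewrite cb.
Qed.

Lemma nbhs_ExtFin (t : seq (set_type E)) (x : set_type (~` E))
    (y : nat -> set_type E) (V : set (Ext E)) :
  set_val (y k) @[k --> \oo] --> set_val x -> nbhs (ExtFin t x) V ->
  \forall k \near \oo, cylinder (rcons t (y k)) `<=` (fun c => V (ExtInf c)).
Proof.
pose F : set_system (Ext E) := fun V => \forall k \near \oo,
  cylinder (rcons t (y k)) `<=` (fun c => V (ExtInf c)).
have FF : Filter F.
  split; rewrite /F.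
  - by apply: nearW => k c.
  - move=> A B FA FB; apply: filterS2 FA FB => k kA kB c kc.
    by split; [exact: kA|exact: kB].
  - by move=> A B AB FA; apply: filterS FA => k kA c /kA /AB.
move=> yx; apply: (@cvg_ext F FF) => t' U oU [tt' [z tz Uz]]; rewrite /F.
(* A shorter [t'] gives a neighbourhood containing the cylinder of [t]; a longer one would read past
   the last entry [x]; at equal lengths [U] is a neighbourhood of [x] and catches [y k] for large
   [k]. *)
have [st|st|st] := ltngtP (size t') (size t).
- apply: nearW => k c /cylinder_rcons[tc _]; split.
    by move=> i it'; rewrite (ext_entry_cylinder x tc) ?tt' // (ltn_trans it').
  by exists z; rewrite // (ext_entry_cylinder x tc).
- by move: tz; rewrite /= onth_default // size_rcons size_map.
move: tz; rewrite st /= -cats1 onth_cat size_map ltnn subnn => -[zE].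
have : nbhs (set_val x) U by apply: open_nbhs_nbhs; split=> //; rewrite zE.
move=> /yx Uy; have {}Uy : \forall k \near \oo, U (set_val (y k)) := Uy.
apply: filterS Uy => k Uk c /cylinder_rcons[tc cy]; split.
  by move=> i it'; rewrite (ext_entry_cylinder x tc) ?tt' // -st.
by exists (set_val (y k)) => //; rewrite st -cy.
Qed.


(** If [t] is shorter than [t'], membership depends on entries of [t'] alone, which its cylinder
    shares; at equal lengths the first clause of [ext_nbhd] forces [t' = t]. *)
Lemma ext_nbhd_ExtFin (x0 : set_type E) (t t' : seq (set_type E))
    (x : set_type (~` E)) (U : set X) :
  ext_nbhd t U (ExtFin t' x) ->
  t' = t \/ cylinder t' `<=` (fun b => ext_nbhd t U (ExtInf b)).
Proof.
move=> [tt' [z tz Uz]]; have [st|st|st] := ltngtP (size t) (size t').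
- right=> b tb; split.
    by move=> i it'; rewrite (ext_entry_cylinder x tb) ?tt' // (ltn_trans it').
  by exists z; rewrite // (ext_entry_cylinder x tb).
- by move: tz; rewrite /= onth_default // size_rcons size_map.
have [b tb] := cylinder_inhabited x0 t'; left.
rewrite -tb -st; apply/(cylinderP x0) => i it; have := tt' i it.
rewrite -(ext_entry_cylinder x tb) -?st //= onthE -map_comp (nth_map x0) //=.
by move=> [/val_inj].
Qed.

End ExtTopologyTheory.

(** * Convergence to infinity in [DNstar D] *)

Section DNTheory.
Variable D : discreteTopologicalType.
Local Notation T := (set_type (DN D)).

Lemma DN_Some (d : D) (k : nat) : DN D (d, Some k).
Proof. by split=> //; exists k. Qed.

Definition DN_pt (d : D) (k : nat) : T := SigSub (mem_set (DN_Some d k)).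

Definition DN_fst (p : T) : D := (set_val p).1.
Definition DN_snd (p : T) : nat := odflt 0 (set_val p).2.

Lemma set_val_DN (p : T) : set_val p = (DN_fst p, Some (DN_snd p)).
Proof.
case: p => -[d o] dp; have [_ [n _ /= no]] := set_mem dp.
by rewrite /DN_fst /DN_snd set_valE /= -no.
Qed.

(** Near-covering compactness: on the neighbourhood [[set i]] of [i], the bound holds for all large
    [k]. *)
Lemma compact_nat_bounded (C : set nat) :
  compact C -> \forall k \near \oo, forall i, C i -> i < k.
Proof.
move=> /compact_near_coveringP /(_ _ \oo (fun k i => i < k) _); apply=> i _.
exists ([set i], [set k | i < k]) => /=.
  by split; [exact: discrete_set1 | exact: nbhs_infty_gt].
by move=> [? ?] [/= ->].
Qed.

Lemma cvg_DN_pt (d : D) :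
  set_val (DN_pt d k) @[k --> \oo] --> set_val (DN_infty_pt d).
Proof.
move=> A [[A1 A2] /= [/nbhs_singleton A1d [C [Ccpt _] CA2]] A12].
have := compact_nat_bounded Ccpt; apply: filterS => k Ck.
apply: A12; split=> //=; apply: CA2; left; exists k => // /Ck.
by rewrite ltnn.
Qed.

(** The numbers below [m] form a finite, hence compact and closed set, so its complement is a
    neighbourhood of infinity. *)
Lemma nbhs_infty_pt (d : D) (m : nat) :
  exists2 U : set (DNstar D), open U /\ U (set_val (DN_infty_pt d)) &
    forall p : T, U (set_val p) -> DN_fst p = d /\ m <= DN_snd p.
Proof.
pose U : set (DNstar D) := [set d] `*` ~` (Some @` `I_m).
have : nbhs ((d, None) : DNstar D) U.
  exists ([set d], ~` (Some @` `I_m)) => //=.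
  split; first exact: discrete_set1.
  exists `I_m; first by split; [exact: finite_compact | exact: discrete_closed].
  by move=> _ [[k km <-]|->] [j jm // [jk]]; apply: km; rewrite -jk.
rewrite nbhsE => -[V [oV Vd] VU]; exists V => // p /VU.
rewrite set_val_DN => -[/= -> nm]; split=> //.
by rewrite leqNgt; apply/negP => h; apply: nm; exists (DN_snd p).
Qed.

End DNTheory.

(** * Mutual exclusion of the two alternatives *)

Lemma nbhs_set_type (X : topologicalType) (A : set X) (x : set_type A)
    (U : set (set_type A)) :
  nbhs x U ->
  exists2 V, nbhs (set_val x) V & forall y : set_type A, V (set_val y) -> U y.
Proof.
case=> _ [[W oW <-] /= Wx WU]; exists W; first exact: open_nbhs_nbhs.
by move=> y /WU.
Qed.

Section Exclusion.
Variables (D : discreteTopologicalType) (d0 : D) (X : D -> topologicalType).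
Variables (R S : set (prod_topology X)).

Local Notation source :=
  (pair_seq (constant_seqs D (Ext (DN D)) (Ext_infinite (DN D))) (H_infty D)).

Lemma hom_dom_ExtInf (b : nat -> set_type (DN D)) (d : D) :
  @hom_dom D (fun=> Ext (DN D)) bool source d (ExtInf b).
Proof.
exists true => //; exists (fun=> ExtInf b) => //=.
by split=> // d'; exists b.
Qed.

Lemma hom_dom_ExtFin (t : seq (set_type (DN D))) (d : D) :
  @hom_dom D (fun=> Ext (DN D)) bool source d (ExtFin t (DN_infty_pt d)).
Proof.
by exists false => //; exists (fun d => ExtFin t (DN_infty_pt d)) => //=;
  exists t.
Qed.

Lemma hom_domP (d : D) (x : Ext (DN D)) :
  @hom_dom D (fun=> Ext (DN D)) bool source d x ->
  (exists b, x = ExtInf b) \/ exists t, x = ExtFin t (DN_infty_pt d).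
Proof.
move=> [[] _ [y /= ys <-]]; rewrite /proj.
  by case: ys => /(_ d)[b _ <-] _; left; exists b.
by case: ys => t ->; right; exists t.
Qed.

Lemma hom_not_separated :
  @has_continuous_hyperrectangular_hom D (fun=> Ext (DN D)) X bool
    source (pair_seq R S) ->
  forall F : set (set (prod_topology X)), countable F ->
  (forall C, F C -> closed_hyperrectangle C) ->
  ~ separates (\bigcup_(C in F) C) R S.
Proof.
move=> [phi [phi_cont phi_hom]] F cF Fcl [RF SF].
pose pinf b d := phi d (SigSub (mem_set (hom_dom_ExtInf b d))).
pose pfin t d := phi d (SigSub (mem_set (hom_dom_ExtFin t d))).
have pinfR b : R (pinf b).
  apply: (phi_hom true (fun d => SigSub (mem_set (hom_dom_ExtInf b d)))).
  by split=> // d; exists b.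
have pfinS t : S (pfin t).
  apply: (phi_hom false (fun d => SigSub (mem_set (hom_dom_ExtFin t d)))).
  by exists t.
(* An empty [F] cannot cover [R], which contains every [pinf b]; otherwise [e] enumerates [F]. *)
have [F0|[e]] := pfcard_geP cF.
  by have [C] := RF _ (pinfR (fun=> DN_pt d0 0)); rewrite F0.
have Fe n : F (e n) by apply: funS.
have [||n [t tB]] := @cylinder_baire _ (DN_pt d0 0) (fun n b => e n (pinf b)).
- move=> b; have [C FC Cb] := RF _ (pinfR b).
  by have [n _ eC] := @surj _ _ _ _ e C FC; exists n; rewrite eC.
- move=> n b; have [Y [Ycl ->]] := Fcl _ (Fe n).
  (* Leaving a closed hyperrectangle is witnessed by a single coordinate, so continuity of [phi d]
     gives a cylinder outside. *)
  move=> /existsNP[d nYd].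
  have : nbhs (pinf b d) (~` Y d).
    by apply: open_nbhs_nbhs; split=> //; exact: closed_openC.
  move=> /phi_cont /nbhs_set_type[V /nbhs_ExtInf[m mV] VY].
  exists m => c /mV Vc; apply/existsNP; exists d.
  exact: VY (SigSub (mem_set (hom_dom_ExtInf c d))) Vc.
suff : (S `&` \bigcup_(C in F) C) (pfin t) by rewrite SF.
split=> //; exists (e n) => //.
have [Y [Ycl eY]] := Fcl _ (Fe n); rewrite eY => d; apply: contrapT => nYd.
have : nbhs (pfin t d) (~` Y d).
  by apply: open_nbhs_nbhs; split=> //; exact: closed_openC.
move=> /phi_cont /nbhs_set_type[V /(nbhs_ExtFin (@cvg_DN_pt D d))[k _ kV] VY].
(* This [b] is in the cylinder of [t], so its image is in [e n], yet its coordinate [d] avoids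
   [Y d]. *)
have [b tb] := cylinder_inhabited (DN_pt d0 0) (rcons t (DN_pt d k)).
have := VY (SigSub (mem_set (hom_dom_ExtInf b d))) (kV k (leqnn k) b tb).
by have [+ _] := (cylinder_rcons _ _ _).1 tb => /tB; rewrite eY => /(_ d).
Qed.

End Exclusion.

(** * Baire space, metric limits and open boxes *)

Lemma nbhs_baire (b : baire) (V : set baire) :
  nbhs b V -> exists m, forall c : baire, (forall i, i < m -> c i = b i) -> V c.
Proof.
pose F := filter_from [set: nat]
  (fun m => [set c : baire | forall i, i < m -> c i = b i]).
have FF : Filter F.
  apply: filter_fromT_filter; first by exists 0.
  move=> m n; exists (maxn m n) => c cb.
  by split=> i im; apply: cb; rewrite leq_max im ?orbT.
suff : F `=>` nbhs b by move=> Fb /Fb[m _ mV]; exists m => c /mV.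
(* The product topology is a supremum over coordinates; coordinate [i] is fixed once [i.+1] entries
   are. *)
apply/cvg_sup => i A [_ [[W _ <-] Wb] /filterS]; apply.
by exists i.+1 => // c cb; rewrite /= /proj cb.
Qed.

(** Distinct points have disjoint balls, but both would contain [z k] for large [k]. *)
Lemma ball_natSinv_eq (K : realType) (M : metricType K) (x y : M)
    (z : nat -> M) :
  (\forall k \near \oo, ball x k.+1%:R^-1%R (z k) /\
    ball y k.+1%:R^-1%R (z k)) ->
  x = y.
Proof.
move=> xyz; apply/eqP; apply: contrapT => /negP xy.
have := @metric_hausdorff K M; rewrite ball_hausdorff
  => /(_ _ _ xy) [[r1 r2] /=].
move=> /eqP xy0; near \oo => k.
have [xk yk] : ball x k.+1%:R^-1%R (z k) /\ ball y k.+1%:R^-1%R (z k).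
  by near: k.
have : (ball x r1%:num `&` ball y r2%:num)%R (z k).
  split; [apply: le_ball xk|apply: le_ball yk];
  apply/Order.POrderTheory.ltW; near: k; exact: near_infty_natSinv_lt.
by rewrite xy0.
Unshelve. all: by end_near. Qed.

Lemma open_box (Z : topologicalType) (U : nat -> set Z) :
  (forall n, open (U n)) ->
  open ([set x | forall n, U n (x n)] : set (box_seq Z)).
Proof.
move=> oU; exists [set [set x | forall n, U n (x n)]].
  2: by rewrite bigcup_set1.
by move=> _ ->; apply: finI_from1; exists U.
Qed.

(** * The approximation dihypergraph and its colourings *)

Section Dichotomy.
Variables (K : realType) (D : discreteTopologicalType) (d0 : D).
Variables (X : D -> metricType K) (R S : set (prod_topology X)).
Hypothesis RS0 : R `&` S = set0.
Variables (h : D * nat -> nat) (g : nat -> D * nat).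
Hypothesis hK : cancel h g.

Let coord (z : set_type R) : forall d, X d := set_val z.
Let radius (k : nat) : K := k.+1%:R^-1%R.

(** Pairs (d, k) are indexed by [nat] through [h] and read back by [g]; a position [n] outside the
    range of [h] repeats the radius and centre of [g n]. Interiors make each condition open. *)
Definition approx_dihypergraph : set (nat -> set_type R) :=
  [set x | exists2 s : forall d, X d, S s &
    forall n, (ball (s (g n).1) (radius (g n).2))° (coord (x n) (g n).1)].

Lemma approx_ball x : approx_dihypergraph x ->
  exists2 s : forall d, X d, S s &
    forall d k, ball (s d) (radius k) (coord (x (h (d, k))) d).
Proof.
move=> [s Ss sx]; exists s => // d k; have := sx (h (d, k)).
by rewrite hK /= => /nbhs_singleton.
Qed.

(** A constant sequence [z] would be within 1/(k+1) of [s] at every coordinate for all [k], making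
    [s] a common point of [R] and [S]. *)
Lemma dihypergraph_approx : dihypergraph approx_dihypergraph.
Proof.
move=> z /approx_ball[s Ss sz].
suff sE : s = coord z.
  by have : (R `&` S) s; [split=> //; rewrite sE; exact: set_valP | rewrite RS0].
apply: functional_extensionality_dep => d.
apply: (@ball_natSinv_eq _ _ _ _ (fun=> coord z d)); apply: nearW => k.
by split; [exact: sz | apply: ballxx;
  rewrite Num.Theory.invr_gt0 Num.Theory.ltr0n].
Qed.

Lemma continuous_coord (d : D) : continuous (fun z : set_type R => coord z d).
Proof.
move=> z; apply: (@continuous_comp _ _ _
  (set_val : set_type R -> prod_topology X) (proj d)).
  exact: initial_continuous.
exact: proj_continuous.
Qed.

Lemma box_open_approx : box_open approx_dihypergraph.
Proof.
rewrite /box_open (_ : approx_dihypergraph = \bigcup_(s in S)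
    [set x | forall n, (ball (s (g n).1) (radius (g n).2))°
      (coord (x n) (g n).1)]); last first.
  by rewrite eqEsubset; split=> x [s Ss sx]; exists s.
apply: bigcup_open => s _; apply: (open_box (U := fun n => [set z : set_type R |
  (ball (s (g n).1) (radius (g n).2))° (coord z (g n).1)])) => n.
have /continuousP := @continuous_coord (g n).1; apply; exact: open_interior.
Qed.

Lemma colouring_separated (kappa : Type) (c : set_type R -> kappa) :
  colouring approx_dihypergraph c -> [set: kappa] #<= [set: nat] ->
  exists F : set (set (prod_topology X)),
    [/\ countable F, (forall C, F C -> closed_hyperrectangle C) &
        separates (\bigcup_(C in F) C) R S].
Proof.
move=> col kappaN.
pose Y k d := closure [set coord z d | z in c @^-1` [set k]].
pose hull k := [set x : prod_topology X | forall d, Y k d (x d)].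
exists (hull @` [set: kappa]); split.
- exact: card_le_trans (card_image_le _ _) kappaN.
- move=> _ [k _ <-]; exists (Y k); split=> // d; exact: closed_closure.
split=> [r Rr|].
  exists (hull (c (SigSub (mem_set Rr)))).
    by exists (c (SigSub (mem_set Rr))).
  by move=> d; apply: subset_closure; exists (SigSub (mem_set Rr)).
rewrite -subset0 => s [Ss [_ [k _ <-] sk]].
(* As [s] lies in the hull of colour [k], each coordinate ball around [s] meets the projection of
   that colour class; the chosen points form a monochromatic edge. *)
have /choice[x xP] n : exists z : set_type R, c z = k /\
    (ball (s (g n).1) (radius (g n).2))° (coord z (g n).1).
  have [] := sk (g n).1 (ball (s (g n).1) (radius (g n).2))°.
    apply: nbhs_interior; apply: nbhsx_ballx.
    by rewrite Num.Theory.invr_gt0 Num.Theory.ltr0n.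
  by move=> _ [[z cz <-] zb]; exists z.
apply: (col x); last by exists k => n; case: (xP n).
by exists s => // n; case: (xP n).
Qed.

(** * The hyperrectangular homomorphism induced by [pi] *)

Local Notation T := (set_type (DN D)).

(** Letters become indices of edge entries, so that [pi] applies to sequences of letters. *)
Let code (p : T) : nat := h (DN_fst p, DN_snd p).

Variable pi : baire -> set_type R.
Hypothesis pi_cont : continuous pi.
Hypothesis pi_hom : homomorphism H_baire approx_dihypergraph pi.

Let val_inf (b : nat -> T) : forall d, X d := coord (pi (code \o b)).

Lemma val_inf_cont b d (e : K) : (0 < e)%R ->
  exists m, cylinder (mkseq b m) `<=`
    (fun c => ball (val_inf b d) e (val_inf c d)).
Proof.
move=> e0; have := continuous_comp (@pi_cont (code \o b))
  (@continuous_coord d _).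
move=> /(_ _ (nbhsx_ballx (val_inf b d) e e0)) /nbhs_baire[m mb].
exists m => c /(cylinderP (b 0)) cb; apply: mb => i im /=.
by rewrite cb ?size_mkseq // nth_mkseq.
Qed.

(* The approximated point does not depend on the approximating sequence:
   changing one entry does not affect limits. *)
Lemma limit_point (t : seq T) : exists s : forall d, X d, S s /\
  forall p b, cylinder (rcons t p) b ->
    ball (s (DN_fst p)) (radius (DN_snd p)) (val_inf b (DN_fst p)).
Proof.
pose u := map code t.
pose x0 n : baire := nth 0 (rcons u n).
have x0P n : baire_cyl (rcons u n) (x0 n) by [].
have hom x : (forall n, baire_cyl (rcons u n) (x n)) ->
    approx_dihypergraph (pi \o x).
  by move=> xP; apply: (pi_hom (x := x)); exists u.
have [s Ss sx0] := approx_ball (hom _ x0P).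
exists s; split=> // p b /cylinder_rcons[tb bp].
(* Only the entry at [code p] changes, to the given [b]; the result is still in [H_baire]. *)
pose x n := if n == code p then (code \o b : baire) else x0 n.
have xP n : baire_cyl (rcons u n) (x n).
  rewrite /x; case: eqP => [->|_]; last exact: x0P.
  move=> i; rewrite size_rcons size_map ltnS nth_rcons size_map /= => it.
  case: ltngtP it => // [it _|-> _]; last by rewrite bp.
  by rewrite (nth_map p) //; have /(cylinderP p) -> := tb.
have [s' _ sx] := approx_ball (hom _ xP).
(* At this coordinate both points are approximated by the entries with [k > DN_snd p], which are
   unchanged. *)
have <- : s' (DN_fst p) = s (DN_fst p).
  apply: (@ball_natSinv_eq _ _ _ _
    (fun k => coord (pi (x0 (h (DN_fst p, k)))) (DN_fst p))).
  exists (DN_snd p).+1 => // k /= pk; split; last exact: sx0.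
  have := sx (DN_fst p) k; rewrite /x /= ifN //; apply/eqP => /(can_inj hK)[kp].
  by rewrite kp ltnn in pk.
by have := sx (DN_fst p) (DN_snd p); rewrite /x /= eqxx.
Qed.

Lemma homomorphism_extends :
  @has_continuous_hyperrectangular_hom D (fun=> Ext (DN D)) X bool
    (pair_seq (constant_seqs D (Ext (DN D)) (Ext_infinite (DN D))) (H_infty D))
    (pair_seq R S).
Proof.
have [s sP] := choice limit_point.
(* The last entry of a finite sequence is ignored: in the domain of index [d] it is always (d,
   oo). *)
pose Phi d (x : Ext (DN D)) : X d :=
  match x with ExtInf b => val_inf b d | ExtFin t _ => s t d end.
(* [s t d] is a limit of values on the cylinder of [t], so a bound there passes to it with loss
   [e]. *)
have s_ball d t (y : X d) (r e : K) : (0 < e)%R ->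
    cylinder t `<=` (fun b => ball y r (val_inf b d)) ->
    ball y (r + e)%R (s t d).
  move=> e0 tb; near \oo => k.
  have [b tkb] := cylinder_inhabited (DN_pt d0 0) (rcons t (DN_pt d k)).
  have := (sP t).2 _ _ tkb; have [tb' _] := (cylinder_rcons _ _ _).1 tkb => sb.
  apply: ball_triangle (tb _ tb') (ball_sym _); apply: le_ball sb.
  apply/Order.POrderTheory.ltW; near: k.
  exact: (near_infty_natSinv_lt (PosNum e0)).
(* A finite point of the neighbourhood either has initial part [t] itself or a whole cylinder
   inside, where [s_ball] applies. *)
have Phi_ball d t U (y : X d) (e : K) : (0 < e)%R -> ball y (e + e)%R (s t d) ->
    (forall b, ext_nbhd t U (ExtInf b) -> ball y e (val_inf b d)) ->
    ext_nbhd t U `<=` (fun z => ball y (e + e)%R (Phi d z)).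
  move=> e0 yt yU [b /yU yb|t' z /(ext_nbhd_ExtFin (DN_pt d 0))[->//|tt']].
    by apply: le_ball yb; rewrite Num.Theory.lerDl Order.POrderTheory.ltW.
  by apply: s_ball => // b /tt' /yU.
exists (fun d x => Phi d (set_val x)); split; last first.
  move=> [] x /=.
    move=> [xinf xconst]; have [b _ xb] := xinf d0.
    rewrite (_ : (fun d => _) = coord (pi (code \o b))); first exact: set_valP.
    apply: functional_extensionality_dep => d.
    by rewrite (xconst d d0) -xb.
  move=> [t xt]; rewrite (_ : (fun d => _) = s t); first exact: (sP t).1.
  by apply: functional_extensionality_dep => d; rewrite xt.
move=> d x A /nbhs_ballP[e /= e0 eA].
have e20 : (0 < e / 2)%R by rewrite Num.Theory.divr_gt0.
suff [t [U [oU xU UA]]] : exists t U, [/\ open U, ext_nbhd t U (set_val x) &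
    ext_nbhd t U `<=`
      (fun z => ball (Phi d (set_val x)) (e / 2 + e / 2)%R (Phi d z))].
  have : nbhs (set_val x) (ext_nbhd t U).
    by apply: open_nbhs_nbhs; split=> //; exact: open_ext_nbhd.
  move=> /(@initial_continuous _ _ (set_val : set_type _ -> Ext (DN D)) x) nU.
  have nU2 : nbhs x (fun z => ext_nbhd t U (set_val z)) := nU.
  by apply: (filterS _ nU2) => z /UA zU; apply: eA;
    rewrite [e]Num.Theory.splitr.
have [[b ->]|[t ->]] : (exists b, set_val x = ExtInf b) \/
    exists t, set_val x = ExtFin t (DN_infty_pt d).
  by exact: hom_domP (set_valP x).
  (* Near an infinite sequence, [m] letters are fixed and [setT] leaves the next one free. *)
  have [m mb] := val_inf_cont b d e20.
  have mbU c : ext_nbhd (mkseq b m) setT (ExtInf c) ->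
      ball (val_inf b d) (e / 2)%R (val_inf c d).
    by move=> /ext_nbhd_ExtInf[/mb].
  exists (mkseq b m), setT; split; first exact: openT.
    by apply/ext_nbhd_ExtInf; split=> //; exact: mem_cylinder_mkseq.
  by apply: Phi_ball => //; exact: s_ball e20 mb.
(* Near t.(d, oo), the next letter of an infinite sequence is confined to (d, j) with j >= k, where
   1/(k+1) < e/2, and [limit_point] bounds the values. *)
have [k _ ke] := near_infty_natSinv_lt (PosNum e20).
have [U [oU Uinf] Uk] := nbhs_infty_pt d k.
exists t, U; split => //.
  split; first by move=> i it; rewrite /= -cats1 onth_cat size_map it.
  exists (set_val (DN_infty_pt d)) => //.
  by rewrite /= -cats1 onth_cat size_map ltnn subnn.
apply: Phi_ball => //; first by apply: ballxx; exact: Num.Theory.addr_gt0.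
move=> b /ext_nbhd_ExtInf[tb /Uk[pd kp]].
have := (sP t).2 (b (size t)) b ((cylinder_rcons _ _ _).2 (conj tb erefl)).
rewrite pd; apply: le_ball; apply/Order.POrderTheory.ltW; exact: ke.
Unshelve. all: by end_near. Qed.

End Dichotomy.

(** * Combining both alternatives, for empty and nonempty [D] *)

Unset Implicit Arguments.

Theorem theorem4p2
    (Gamma : topologicalType -> Prop) (hOGD : OGD Gamma)
    (K : realType) (D : discreteTopologicalType)
    (hD : countable [set: D]) (X : D -> metricType K)
    (R S : set (prod_topology X)) (hRS : R `&` S = set0)
    (hR : Gamma (set_type R)) :
  let separated :=
    exists F : set (set (prod_topology X)),
      [/\ countable F,
          (forall C, F C -> closed_hyperrectangle C) &
          separates (\bigcup_(C in F) C) R S] in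
  let hom :=
    @has_continuous_hyperrectangular_hom
      D (fun=> Ext (DN D)) (fun d => X d) bool
      (pair_seq (constant_seqs D (Ext (DN D)) (Ext_infinite (DN D))) (H_infty D))
      (pair_seq R S) in
  (separated /\ ~ hom) \/ (~ separated /\ hom).
Proof.
move=> separated hom.
have excl : (exists d : D, True) -> hom -> ~ separated.
  move=> [d0 _] hm [F [cF Fcl RFS]].
  exact: (hom_not_separated d0 hm cF Fcl RFS).
have [d0|D0] := pselect (exists d : D, True); last first.
  have eqX (x y : prod_topology X) : x = y.
    by apply: functional_extensionality_dep => d; case: D0; exists d.
  left; split.
    (* For empty [D] the product is a single point, so [S] is empty if [R] is not, and the whole
       space separates; for empty [R] the empty union does. *)
    exists [set C | C = setT /\ R !=set0]; split.
    - apply: sub_countable (countable1 (setT : set (prod_topology X))).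
      by apply: subset_card_le => C [].
    - move=> C [-> _]; exists (fun=> setT); split=> [d|]; first exact: closedT.
      by rewrite eqEsubset; split.
    split=> [r Rr|]; first by exists setT => //; split=> //; exists r.
    rewrite -subset0 => x [Sx [C [_ [r Rr]] _]].
    by rewrite -hRS; split=> //; rewrite (eqX x r).
  (* The empty sequence lies in both source relations, so its image would lie in both [R] and
     [S]. *)
  move=> [phi [_ phi_hom]].
  pose x d : set_type (@hom_dom D (fun=> Ext (DN D)) bool
      (pair_seq (constant_seqs D _ (Ext_infinite (DN D))) (H_infty D)) d) :=
    False_rect _ (D0 (ex_intro _ d I)).
  have Rx := phi_hom true x; have Sx := phi_hom false x.
  suff : (R `&` S) (fun d => phi d (x d)) by rewrite hRS.
  split; [apply: Rx|apply: Sx].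
    by split=> d; case: (D0); exists d.
  by exists [::] => d; case: (D0); exists d.
suff [sep|hm] : separated \/ hom; first by left; split=> // /(excl d0).
  by right; split=> //; exact: excl.
case: d0 => d0 _.
have /countable_injP[f f_inj] := hD.
(* Countability of [D] gives [f], and [pickle] codes pairs of naturals, so [h] is injective. *)
pose h (p : D * nat) : nat := pickle (f p.1, p.2).
have h_inj : injective h.
  move=> [d k] [d' k'] /(pcan_inj pickleK)[dd' ->].
  by rewrite (f_inj d d') // inE.
pose g := 'pinv_(fun=> (d0, 0)) [set: D * nat] h.
have hK : cancel h g by move=> p; apply: pinvKV; rewrite ?inE //; exact: in2W.
have [[kappa [[[c col] _] kappaN]]|[pi [pi_cont pi_hom]]] :=
  hOGD _ hR _ (dihypergraph_approx hRS hK) (@box_open_approx K D X R S g).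
  by left; exact: colouring_separated col kappaN.
by right; exact (homomorphism_extends d0 hK pi_cont pi_hom).
Qed.
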